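(* Let $A$ be a complex Banach space, let $1<p\le\infty$ and $1/p+1/q=1$ (so $q=1$ when $p=\infty$). A linear operator $\Lambda:\ell^q\to A$ is compact if and only if $\Lambda=\Lambda_{\mathbf a}$ for some $\mathbf a\in\ell^p_c(A)$.
   Context: All vector spaces are over $\mathbb C$. $A^*$ is the topological dual of $A$ and $A^*_1=\{\phi\in A^*:\|\phi\|\le 1\}$. For a sequence $\mathbf a=(a_1,a_2,\dots)$ in $A$ and $\phi\in A^*$, put $\phi(\mathbf a)=(\phi(a_1),\phi(a_2),\dots)$. $\ell^p_c(A)$ is the set of all sequences $\mathbf a$ in $A$ such that $\{\phi(\mathbf a):\phi\in A^*_1\}$ is contained in $\ell^p$ and is a totally bounded subset of $\ell^p$. For such $\mathbf a$, $\Lambda_{\mathbf a}:\ell^q\to A$ is defined by the norm-convergent series $\Lambda_{\mathbf a}(\beta)=\sum_{i=1}^\infty\beta_i a_i$, $\beta=(\beta_i)\in\ell^q$. An operator is compact if the image of the closed unit ball is relatively compact. *)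

(* Defs.v *)
From HB Require Import structures.
From mathcomp Require Import all_boot all_order all_algebra.
From mathcomp Require Import all_classical all_reals all_analysis.
From mathcomp Require Import finmap ess_sup_inf complex.

Set Implicit Arguments.
Unset Strict Implicit.
Unset Printing Implicit Defensive.

Import Order.TTheory GRing.Theory Num.Theory.
Import numFieldNormedType.Exports.
Import ComplexField.Normc.

Local Open Scope classical_set_scope.
Local Open Scope complex_scope.
Local Open Scope ring_scope.

Section lnorm.
Context {R : realType}.
Implicit Types (p : \bar R) (x y : nat -> R[i]).

(* The norm of R[i] takes its values in R[i] whereas Lnorm is about (extended)
   real-valued functions, hence normc, the modulus as an element of R. *)
Definition lnorm p x : \bar R :=
  'N[@counting nat R]_p[EFin \o (fun n => normc (x n))]%E.

Lemma normc_ge0 (z : R[i]) : 0 <= normc z.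
Proof. by case: z => a b; exact: sqrtr_ge0. Qed.

Lemma lnorm_fin (p : R) x : 0 < p ->
  lnorm p%:E x = ((\sum_(n <oo) ((normc (x n) `^ p)%:E)) `^ p^-1)%E.
Proof.
move=> p0; rewrite /lnorm Lnorm_counting//; congr (_ `^ _)%E.
by apply: eq_eseriesr => n _ /=; rewrite ger0_norm// normc_ge0.
Qed.

Lemma counting_gt0 : (0 < @counting nat R [set: nat])%E.
Proof.
rewrite /counting; case: asboolP => [/finite_setPn|_]; last by rewrite ltry.
by have /infiniteP := infinite_nat.
Qed.

Lemma counting_ae (P : nat -> Prop) :
  {ae @counting nat R, forall n, P n} -> forall n, P n.
Proof.
move=> [N [mN N0 PN]] n; apply: contrapT => Pn.
have : (@counting nat R [set n] <= @counting nat R N)%E.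
  apply: le_measure; [exact: mem_set | exact: mem_set |].
  by move=> _ ->; exact: PN.
rewrite N0 /counting asboolT ?finite_set1// fset_set1 cardfs1.
by rewrite lee_fin ler10.
Qed.

Lemma lnorm_pinfty x :
  lnorm +oo x = ereal_sup [set (normc (x n))%:E | n in [set: nat]].
Proof.
rewrite /lnorm unlock /Lnorm counting_gt0; apply/eqP; rewrite eq_le.
apply/andP; split.
  apply/ess_supP/nearW => n /=; apply: ereal_sup_ubound => /=; exists n => //.
  by rewrite ger0_norm ?normc_ge0.
apply: ge_ereal_sup => _ [n _ <-].
have := counting_ae (ess_sup_ge (@counting nat R)
  (abse \o (EFin \o (fun n => normc (x n)))))%E.
by move=> /(_ n) /=; rewrite ger0_norm ?normc_ge0.
Qed.

Lemma lnorm_ge0 p x : (0 <= lnorm p x)%E.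
Proof. exact: Lnorm_ge0. Qed.

Lemma lnorm0 p : (1 <= p)%E -> lnorm p 0 = 0%E.
Proof.
move=> p1; rewrite /lnorm -[RHS](@Lnorm0 _ _ _ (@counting nat R) p).
  by apply: eq_Lnorm => n; congr (_%:E); exact: normc0.
by rewrite gt_eqF// (lt_le_trans _ p1).
Qed.

Lemma lnorm_eq0 p x : (1 <= p)%E -> lnorm p x = 0%E -> x = 0.
Proof.
move=> p1 /Lnorm_eq0_eq0 x0; apply/funext => n; apply: eq0_normc.
have {}x0 : EFin \o (fun n => normc (x n)) = \0%E %[ae @counting nat R].
  by apply: x0 => //; rewrite (lt_le_trans _ p1).
by have /(_ I)[] := counting_ae x0 n.
Qed.

Lemma lnormD p x y : (1 <= p)%E -> (lnorm p (x + y)%R <= lnorm p x + lnorm p y)%E.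
Proof.
move=> p1; apply: (@le_trans _ _ ('N[@counting nat R]_p
    [EFin \o ((fun n => normc (x n)) \+ (fun n => normc (y n)))%R])%E); last first.
  exact: eminkowski.
have le_xy n : `|normc ((x + y) n)| <= `|normc (x n) + normc (y n)|.
  by rewrite !ger0_norm ?addr_ge0 ?normc_ge0// le_normcD.
rewrite /lnorm unlock /Lnorm; case: p p1 => [r r1|_|//].
- have r0 : 0 <= r by rewrite -lee_fin (le_trans _ r1).
  have int_ge0 (f : nat -> \bar R) :
      (\int[@counting nat R]_n `|f n| `^ r)%E \in `[0%E, +oo%E].
    by rewrite in_itv/= leey andbT; apply: integral_ge0 => n _; exact: poweR_ge0.
  apply: gt0_ler_poweR; rewrite ?invr_ge0 ?int_ge0//.
  apply: ge0_le_integral => //= n _; rewrite ?lee_fin ?powR_ge0//.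
  by rewrite ge0_ler_powR// ?nnegrE.
- rewrite counting_gt0; apply: le_ess_sup; apply/nearW => n /=.
  by rewrite lee_fin.
Qed.

Lemma lnormZ p (c : R[i]) x : (1 <= p)%E ->
  lnorm p (c *: x) = ((normc c)%:E * lnorm p x)%E.
Proof.
have normE n : `|normc ((c *: x) n)| = normc c * `|normc (x n)|.
  by rewrite normcM normrM ger0_norm// normc_ge0.
rewrite /lnorm unlock /Lnorm; case: p => [r r1|_|//].
- have r0 : 0 < r by rewrite -lte_fin (lt_le_trans _ r1).
  under eq_integral => n _ do
    rewrite /= normE powRM ?normc_ge0// EFinM.
  rewrite ge0_integralZl ?lee_fin ?powR_ge0//.
  rewrite poweRM ?lee_fin ?powR_ge0//; last first.
    by apply: integral_ge0 => n _; rewrite lee_fin powR_ge0.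
  by rewrite poweR_EFin -powRrM divff ?gt_eqF// powRr1 ?normc_ge0.
- rewrite counting_gt0 -ess_supZl ?normc_ge0 ?counting_gt0//.
  by apply/eq_ess_sup/nearW => n /=; rewrite normE EFinM.
Qed.

End lnorm.

Section ellp_pred.
Context {R : realType}.
Variable p : \bar R.

Definition ellp : {pred nat -> R[i]} := [pred x | (lnorm p x < +oo)%E].
Definition ellp_key : pred_key ellp. Proof. exact. Qed.
Canonical ellp_keyed := KeyedPred ellp_key.

Lemma ellpE x : (x \in ellp) = (lnorm p x < +oo)%E.
Proof. by []. Qed.

End ellp_pred.

(* The space l^p for 1 <= p <= +oo; as for LfunType, the proof of 1 <= p is
   part of the type, because it is needed for the normed module structure.
   Sequences are indexed from 0. *)
Record ell (R : realType) (p : \bar R) (p1 : (1 <= p)%E) := Ell {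
  ell_val :> nat -> R[i] ;
  ell_valP : ell_val \in ellp p }.

Arguments ell_val {R p p1} _ _.

Section ell_normedModType.
Context {R : realType} (p : \bar R) (p1 : (1 <= p)%E).

HB.instance Definition _ := [isSub for @ell_val R p p1].
HB.instance Definition _ := [Choice of ell p1 by <:].

Lemma ellp_submod_closed : submod_closed (ellp p).
Proof.
split=> [|c x y]; first by rewrite ellpE lnorm0.
rewrite !ellpE => xoo yoo; apply: (le_lt_trans (lnormD _ _ p1)).
by rewrite lte_add_pinfty// lnormZ// lte_mul_pinfty// lee_fin normc_ge0.
Qed.

HB.instance Definition _ := GRing.isSubmodClosed.Build _ _ (ellp p)
  ellp_submod_closed.
HB.instance Definition _ := [SubChoice_isSubLmodule of ell p1 by <:].

Definition ell_norm (x : ell p1) : R[i] := (fine (lnorm p x))%:C.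

Lemma fine_lnorm (x : ell p1) : (fine (lnorm p x))%:E = lnorm p x.
Proof.
rewrite fineK// ge0_fin_numE ?lnorm_ge0//.
by have := ell_valP x; rewrite ellpE.
Qed.

Lemma ell_normD x y : ell_norm (x + y) <= ell_norm x + ell_norm y.
Proof.
pose r (z : ell p1) := fine (lnorm p (ell_val z)).
have : ((r (x + y))%:E <= (r x)%:E + (r y)%:E)%E.
  by rewrite /r !fine_lnorm; exact: lnormD.
by rewrite -EFinD lee_fin -lecR rmorphD.
Qed.

Lemma ell_normZ (c : R[i]) x : ell_norm (c *: x) = `|c| * ell_norm x.
Proof.
have -> : `|c| = (normc c)%:C by case: c.
rewrite /ell_norm -rmorphM; congr (_%:C); apply: EFin_inj.
by rewrite EFinM !fine_lnorm; exact: lnormZ.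
Qed.

Lemma ell_norm_eq0 x : ell_norm x = 0 -> x = 0.
Proof.
move=> [x0]; apply/val_inj/(lnorm_eq0 p1).
by rewrite -fine_lnorm x0.
Qed.

HB.instance Definition _ := Lmodule_isNormed.Build R[i] (ell p1)
  ell_normD ell_normZ ell_norm_eq0.

End ell_normedModType.

Definition totally_bounded {K : numFieldType} {T : pseudoMetricType K}
    (S : set T) :=
  forall e : K, 0 < e ->
    exists2 F : set T, finite_set F & S `<=` \bigcup_(x in F) ball x e.

Definition compact_operator {K : numFieldType} {E F : normedModType K}
    (L : E -> F) :=
  precompact (L @` [set x | `|x| <= 1]).

Section ellc.
Context {R : realType} (A : normedModType R[i]).

Definition opnorm (phi : {linear A -> R[i]^o}) : \bar R :=
  ereal_sup [set (normc (phi x))%:E | x in [set x : A | `|x| <= 1]].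

Definition dual_ball : set {linear A -> R[i]^o} :=
  [set phi : {linear A -> R[i]^o} | continuous phi /\ (opnorm phi <= 1)%E].

Definition dual_image (a : nat -> A) : set (nat -> R[i]) :=
  (fun (phi : {linear A -> R[i]^o}) (i : nat) => phi (a i)) @` dual_ball.

Definition ellc (p : \bar R) (p1 : (1 <= p)%E) : set (nat -> A) :=
  [set a | dual_image a `<=` [set` ellp p] /\
    totally_bounded (@ell_val R p p1 @^-1` dual_image a)].

(* limn has a default value on divergent sequences; the series converges when
   a is in ellc p1 with p and q conjugate exponents and q < +oo. *)
Definition Lambda (q : \bar R) (q1 : (1 <= q)%E) (a : nat -> A)
    (b : ell q1) : A :=
  limn (series (fun i => b i *: a i)).

End ellc.

(* Main.v *)
(** Put phi(a) = (phi(a_i))_i. If Lambda v = sum_i v_i a_i, then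
    phi(Lambda v) = sum_i v_i phi(a_i), so that, by Hoelder's inequality and its
    converse, the p-norm of phi(a) - psi(a) is the supremum of
    |phi(Lambda v) - psi(Lambda v)| over the unit ball of l^q, while by
    Hahn-Banach the norm of Lambda v - Lambda w is its supremum over phi in the
    dual ball. The pairing (v, phi) |-> phi(Lambda v) thus defines a
    pseudometric on each of the two balls, and if one of them is totally bounded
    so is the other (Schauder): approximate the first variable by finitely many
    points, and partition the second ball according to the approximate values of
    the pairing at these points. *)
From HB Require Import structures.
Require Import Defs.
From mathcomp Require Import all_boot all_order all_algebra.
From mathcomp Require Import all_classical all_reals all_analysis.
From mathcomp Require Import complex.
From mathcomp Require Import ring lra finmap.
Import Order.TTheory GRing.Theory Num.Theory.
Import numFieldNormedType.Exports.
Local Open Scope classical_set_scope.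
Local Open Scope complex_scope.
Local Open Scope ring_scope.
Import ComplexField.Normc.

Set Implicit Arguments.
Unset Strict Implicit.
Unset Printing Implicit Defensive.

(** * A norming functional *)

Section sublinear.
Context {R : realType} {V : lmodType R[i]}.
Implicit Types (m : V -> R) (x y : V).

(** Homogeneity is required for real scalars only, and as an inequality; equality for [r > 0]
    follows by rescaling with [r^-1]. *)
Definition sublinear m :=
  (forall x y, m (x + y) <= m x + m y) /\
  (forall (r : R) x, 0 <= r -> m (r%:C *: x) <= r * m x).

Lemma sublinear0 m : sublinear m -> m 0 = 0.
Proof.
move=> [mD mZ]; have := mD 0 0; have := mZ 0 0 (lexx _).
by rewrite scaler0 addr0 mul0r; lra.
Qed.

Lemma sublinearN m x : sublinear m -> - m (- x) <= m x.
Proof.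
move=> sm; have := sm.1 x (- x); rewrite subrr (sublinear0 sm); lra.
Qed.

(** Serves both for the one-parameter family of [sublinear_shift] and for chains in Zorn's lemma.
    The common minorant [l] keeps the infima finite, and the last two hypotheses let a single member
    of [F] dominate each sum or multiple. *)
Lemma sublinear_inf (F : set (V -> R)) (l : V -> R) : F !=set0 ->
  (forall f x, F f -> l x <= f x) ->
  (forall f g x y, F f -> F g -> exists2 h, F h & h (x + y) <= f x + g y) ->
  (forall f (r : R) x, F f -> 0 <= r ->
    exists2 h, F h & h (r%:C *: x) <= r * f x) ->
  let m := fun x => inf [set f x | f in F] in
  sublinear m /\ (forall f x, F f -> m x <= f x).
Proof.
move=> [f0 Ff0] lF FD FZ m.
have mF f x : F f -> m x <= f x.
  move=> Ff; apply: ge_inf; last by exists f.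
  by exists (l x) => _ [g Fg <-]; exact: lF.
have mG x c : (forall f, F f -> c <= f x) -> c <= m x.
  move=> cF; apply: lb_le_inf; first by exists (f0 x); exists f0.
  by move=> _ [g Fg <-]; exact: cF.
split=> //; split=> [x y|r x].
  rewrite -lerBlDr; apply: (mG) => f Ff; rewrite lerBlDr -lerBlDl.
  apply: mG => g Fg; rewrite lerBlDl.
  have [h Fh hfg] := FD _ _ x y Ff Fg.
  exact: le_trans (mF _ _ Fh) hfg.
rewrite le_eqVlt => /predU1P[<-|r0].
  have [h Fh hf] := FZ f0 0 x Ff0 (lexx _).
  by rewrite mul0r in hf; rewrite mul0r (le_trans (mF _ _ Fh)).
rewrite -ler_pdivrMl//; apply: mG => f Ff; rewrite ler_pdivrMl//.
have [h Fh hf] := FZ f r x Ff (ltW r0).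
exact: le_trans (mF _ _ Fh) hf.
Qed.

(* The witness is x |-> inf_(t >= 0) (m (x + t y) - t m y). *)
Lemma sublinear_shift m y : sublinear m ->
  exists m', [/\ sublinear m', forall x, m' x <= m x & m' (- y) <= - m y].
Proof.
move=> sm; have [mD mZ] := sm.
pose f (t : R) x := m (x + t%:C *: y) - t * m y.
have [||||m's m'f] := @sublinear_inf [set f t | t in [set t | 0 <= t]]
    (fun x => - m (- x)).
- by exists (f 0), 0 => //=.
- move=> _ x [t /= t0 <-].
  have := mD (x + t%:C *: y) (- x); rewrite addrAC subrr add0r /f.
  have := mZ t y t0; have := sublinearN (t%:C *: y) sm.
  have [->|tn0] := eqVneq t 0.
    by rewrite scale0r oppr0 (sublinear0 sm); lra.
  have t_gt0 : 0 < t by rewrite lt0r tn0.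
  (* Homogeneity with the factor [t^-1] gives the reverse bound [t * m y <= m (t y)], which is what
     keeps the infimum above [- m (- x)]. *)
  have : m y <= t^-1 * m (t%:C *: y).
    rewrite -{1}(scale1r y) -(rmorph1 (real_complex R)) -(mulVf tn0) rmorphM.
    by rewrite -scalerA; apply: mZ; rewrite invr_ge0.
  rewrite ler_pdivlMl//; lra.
- move=> _ _ x x' [t /= t0 <-] [s /= s0 <-].
  exists (f (t + s)); first by exists (t + s) => //=; exact: addr_ge0.
  rewrite /f rmorphD/= scalerDl addrACA.
  have := mD (x + t%:C *: y) (x' + s%:C *: y); lra.
- move=> _ r x [t /= t0 <-] r0.
  exists (f (r * t)); first by exists (r * t) => //=; exact: mulr_ge0.
  rewrite /f rmorphM/= -scalerA -scalerDr.
  have := mZ r (x + t%:C *: y) r0; lra.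
(* The parameter [t = 0] gives [m' <= m], and [t = 1] at the point [- y] gives
   [m 0 - m y = - m y]. *)
exists (fun x => inf [set g x | g in [set f t | t in [set t | 0 <= t]]]).
split=> // [x|].
  have -> : m x = f 0 x by rewrite /f scale0r addr0 mul0r subr0.
  by apply: m'f; exists 0 => /=.
have -> : - m y = f 1 (- y).
  by rewrite /f scale1r addNr (sublinear0 sm) mul1r add0r.
by apply: m'f; exists 1 => /=.
Qed.

(* Zorn's lemma: a minimal sublinear functional is odd, by sublinear_shift. *)
Lemma sublinear_minorant m : sublinear m ->
  exists u, [/\ sublinear u, forall x, u x <= m x & forall x, u (- x) = - u x].
Proof.
move=> sm; pose T := {u | sublinear u /\ forall x, u x <= m x}.
(* The order is reversed, so that a maximal element is a minimal functional. *)
pose ord (s t : T) := `[< forall x, sval t x <= sval s x >].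
have [||||u umin] := @Zorn T ord.
- by move=> t; apply/asboolP.
- move=> r s t /asboolP rs /asboolP st; apply/asboolP => x.
  exact: le_trans (st x) (rs x).
- move=> [s Ps] [t Pt] /asboolP st /asboolP ts; apply: eq_exist => /=.
  by apply/funext => x; apply/eqP; rewrite eq_le st ts.
- move=> A Atot.
  have [[a0 Aa0]|A0] := pselect (A !=set0); last first.
    have Pm : sublinear m /\ forall x, m x <= m x by [].
    by exists (exist _ m Pm) => s As; case: A0; exists s.
  have [||||ms mA] := @sublinear_inf [set sval a | a in A] (fun x => - m (- x)).
  + by exists (sval a0), a0.
  + move=> _ x [a Aa <-]; apply: le_trans (sublinearN _ (svalP a).1).
    by rewrite lerN2; exact: (svalP a).2.
  + move=> _ _ x y [a Aa <-] [b Ab <-].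
    (* Of two members of a chain, the smaller one dominates the sum. *)
    have [/asboolP ab|/asboolP ba] := Atot _ _ Aa Ab.
      exists (sval b); first by exists b.
      by apply: le_trans ((svalP b).1.1 _ _) _; rewrite lerD2r.
    exists (sval a); first by exists a.
    by apply: le_trans ((svalP a).1.1 _ _) _; rewrite lerD2l.
  + move=> _ r x [a Aa <-] r0; exists (sval a); first by exists a.
    exact: (svalP a).1.2.
  pose n x := inf [set f x | f in [set sval a | a in A]].
  have Pn : sublinear n /\ forall x, n x <= m x.
    split=> // x; apply: le_trans ((svalP a0).2 x).
    by apply: mA; exists a0.
  by exists (exist _ n Pn) => s As; apply/asboolP => x /=; apply: mA; exists s.
have [su um] := svalP u; exists (sval u); split=> // y.
have [u' [su' u'u u'y]] := sublinear_shift y su.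
have Pu' : sublinear u' /\ forall x, u' x <= m x.
  by split=> // x; exact: le_trans (u'u x) (um x).
(* By minimality the shift [u'] equals [u], so that [u (- y) <= - u y]. *)
have := umin (exist _ u' Pu') (asboolT u'u) => uu'.
apply/eqP; rewrite eq_le; apply/andP; split.
  by move: u'y; rewrite -uu'.
by rewrite lerNl; exact: sublinearN.
Qed.

End sublinear.

(** * The norm as a real number *)

Section rnorm.
Context {R : realType} {V : normedModType R[i]}.
Implicit Types (x y : V).

(* The norms of the library take values in R[i]; this is the same norm in R. *)
Definition rnorm x : R := complex.Re `|x|.

Lemma normE x : `|x| = (rnorm x)%:C.
Proof. by rewrite RRe_real// ger0_real. Qed.

Lemma rnorm_ge0 x : 0 <= rnorm x.
Proof. by rewrite -ler0c -normE. Qed.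

Lemma ler_rnormD x y : rnorm (x + y) <= rnorm x + rnorm y.
Proof. by rewrite -lecR rmorphD/= -!normE ler_normD. Qed.

Lemma rnormZ (c : R[i]) x : rnorm (c *: x) = normc c * rnorm x.
Proof.
by apply: complexI; rewrite rmorphM/= -!normE normrZ.
Qed.

Lemma rnormN x : rnorm (- x) = rnorm x.
Proof. by rewrite /rnorm normrN. Qed.

Lemma rnormB x y : rnorm (x - y) = rnorm (y - x).
Proof. by rewrite -rnormN opprB. Qed.

Lemma rnorm0 : rnorm 0 = 0.
Proof. by rewrite /rnorm normr0. Qed.

Lemma rnorm_eq0 x : rnorm x = 0 -> x = 0.
Proof. by move=> x0; apply/eqP; rewrite -normr_eq0 normE x0. Qed.

Lemma normcR (r : R) : normc r%:C = `|r|.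
Proof. by rewrite /normc/= expr0n addr0 sqrtr_sqr. Qed.

Lemma sublinear_rnorm : sublinear rnorm.
Proof.
split=> [|r x r0]; first exact: ler_rnormD.
by rewrite rnormZ normcR ger0_norm.
Qed.

Lemma ballR (e : R) x y : ball x e%:C y = (rnorm (x - y) < e) :> Prop.
Proof. by rewrite -ball_normE/= normE ltcR. Qed.

Lemma ler_normcRe (z : R[i]) : complex.Re z <= normc z.
Proof.
case: z => a b /=; apply: le_trans (ler_norm a) _.
by rewrite -sqrtr_sqr ler_wsqrtr// lerDl sqr_ge0.
Qed.

End rnorm.

(** * Functionals in the dual ball *)

Section dual.
Context {R : realType} {A : normedModType R[i]}.
Implicit Types (phi : {linear A -> R[i]^o}) (x : A).

(** Turns continuity and a supremum over the unit ball into one pointwise bound: the bound implies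
    continuity, and conversely [x] is rescaled to norm one. *)
Lemma dual_ballP phi :
  dual_ball phi <-> forall x, normc (phi x) <= rnorm x.
Proof.
split=> [[_ phi1] x|phi1]; last first.
  split.
    apply: bounded_linear_continuous; apply/linear_boundedP; near=> r => x.
    rewrite (_ : `|phi x| = (normc (phi x))%:C); last by case: (phi x).
    rewrite (le_trans (_ : _ <= (rnorm x)%:C))//; first by rewrite lecR.
    rewrite -normE ler_peMl//; near: r; apply: nbhs_pinfty_ge.
  apply: ge_ereal_sup => _ [x /= x1 <-].
  by rewrite lee_fin (le_trans (phi1 x))// -lecR -normE.
have [x0|x0] := eqVneq x 0.
  by rewrite x0 linear0 normc0 rnorm0.
have nx0 : rnorm x != 0 by apply: contra_neq x0; exact: rnorm_eq0.
pose y := (rnorm x)^-1%:C *: x.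
have y1 : rnorm y = 1.
  by rewrite rnormZ normcR ger0_norm ?invr_ge0 ?rnorm_ge0// mulVf.
have : ((normc (phi y))%:E <= 1)%E.
  apply: le_trans phi1; apply: ereal_sup_ubound; exists y => //=.
  by rewrite normE y1.
rewrite lee_fin linearZ normcM normcR ger0_norm ?invr_ge0 ?rnorm_ge0//.
by rewrite ler_pdivrMl ?mulr1// lt0r nx0 rnorm_ge0.
Unshelve. all: by end_near. Qed.

(* u extends to the functional x |-> u x - i u (i x), which has the same norm
   because its value at x can be rotated to be real. *)
Lemma real_minorant_complex (u : A -> R) : sublinear u ->
    (forall x, u x <= rnorm x) -> (forall x, u (- x) = - u x) ->
  exists2 phi, dual_ball phi & forall x, complex.Re (phi x) = u x.
Proof.
move=> su u1 uN; have [uD uZ] := su.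
(* Oddness makes [u] additive: [u x = u ((x + y) - y) <= u (x + y) - u y]. *)
have uDE x y : u (x + y) = u x + u y.
  apply/eqP; rewrite eq_le uD/=.
  by have := uD (x + y) (- y); rewrite addrK uN; lra.
have uZE (r : R) x : u (r%:C *: x) = r * u x.
  have uZp (s : R) y : 0 <= s -> u (s%:C *: y) = s * u y.
    move=> s0; apply/eqP; rewrite eq_le uZ//=.
    by have := uZ s (- y) s0; rewrite scalerN !uN mulrN lerN2.
  have [r0|r0] := leP 0 r; first exact: uZp.
  rewrite -[r]opprK rmorphN/= scaleNr uN mulNr uZp// oppr_ge0; exact: ltW.
pose f (x : A) : R[i]^o := u x +i* - u ('i *: x).
have fD x y : f (x + y) = f x + f y.
  by rewrite /f scalerDr !uDE opprD.
have fR (r : R) x : f (r%:C *: x) = r%:C * f x.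
  by rewrite /f scalerA mulrC -scalerA !uZE; simpc.
have fi x : f ('i *: x) = 'i * f x.
  by rewrite /f scalerA -expr2 sqr_i scaleN1r uN opprK; simpc.
have flin : linear f.
  move=> c x y; rewrite fD; congr (_ + _).
  rewrite [c in LHS]complexE scalerDl fD fR -scalerA fi fR.
  by rewrite mulrA -mulrDl -complexE.
pose phi : {linear A -> R[i]^o} :=
  HB.pack f (GRing.isLinear.Build _ _ _ _ f flin).
exists phi => //; apply/dual_ballP => x.
have [fx0|fx0] := eqVneq (f x) 0; first by rewrite [phi x]fx0 normc0 rnorm_ge0.
have nfx0 : normc (f x) != 0 by apply: contra_neq fx0; exact: eq0_normc.
pose c : R[i] := (normc (f x))%:C / f x.
have c1 : normc c = 1.
  by rewrite normcM normcR normcV ger0_norm ?normc_ge0// mulfV.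
have -> : normc (phi x) = complex.Re (f (c *: x)).
  rewrite (_ : f (c *: x) = c * f x); last exact: (linearZ_LR phi).
  by rewrite /c mulfVK.
by rewrite /= (le_trans (u1 _))// rnormZ c1 mul1r.
Qed.

(** Shifting the norm at [x] gives [m <= rnorm] with [m (- x) <= - rnorm x]. An odd sublinear
    [u <= m] then satisfies [- u x = u (- x) <= - rnorm x], and [u] is the real part of the
    functional sought. *)
Lemma norming_functional x :
  exists2 phi, dual_ball phi & rnorm x <= normc (phi x).
Proof.
have [m [sm m1 mx]] := sublinear_shift x sublinear_rnorm.
have [u [su um uN]] := sublinear_minorant sm.
have u1 y : u y <= rnorm y by exact: le_trans (um y) (m1 y).
have [phi phi1 phiu] := real_minorant_complex su u1 uN.
exists phi => //; apply: le_trans (ler_normcRe _); rewrite phiu -lerN2 -uN.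
exact: le_trans (um _) mx.
Qed.

End dual.

(** * Finite partitions and total boundedness *)

Section finite_partition.
Context {T : Type}.
Implicit Types (D : set T) (E : T -> T -> Prop).

(** A finite colouring under which points of [D] of equal colour are related by [E]. It involves no
    centres, and [E] need not be an equivalence, so it passes easily to intersections, preimages and
    images. *)
Definition finpart D E :=
  exists (F : finType) (q : T -> F),
    forall x y, D x -> D y -> q x = q y -> E x y.

Lemma sub_finpart D E E' : (forall x y, D x -> D y -> E x y -> E' x y) ->
  finpart D E -> finpart D E'.
Proof.
move=> EE' [F [q qE]]; exists F, q => x y Dx Dy xy.
by apply: EE' => //; exact: qE.
Qed.

Lemma finpartI D E E' : finpart D E -> finpart D E' ->
  finpart D (fun x y => E x y /\ E' x y).
Proof.
move=> [F [q qE]] [F' [q' qE']]; exists (F * F')%type, (fun x => (q x, q' x)).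
by move=> x y Dx Dy [xy xy']; split; [exact: qE|exact: qE'].
Qed.

Lemma finpart_forall (I : finType) D (E : I -> T -> T -> Prop) :
  (forall i, finpart D (E i)) -> finpart D (fun x y => forall i, E i x y).
Proof.
move=> DE.
suff : finpart D (fun x y => forall i, i \in enum I -> E i x y).
  by apply: sub_finpart => x y _ _ Exy i; apply: Exy; rewrite mem_enum.
elim: (enum I) => [|i s IHs]; first by exists unit, (fun=> tt).
apply: sub_finpart (finpartI (DE i) IHs) => x y _ _ [Exy Esxy] j.
by rewrite inE => /predU1P[->|/Esxy].
Qed.

Lemma finpart_representatives D E : finpart D E ->
  exists (F : finType) (r : F -> T),
    (forall i, D (r i)) /\ (forall x, D x -> exists i, E x (r i)).
Proof.
move=> [F [q qE]].
(* Only colours attained on [D] are kept, so that each has a representative in [D]. *)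
pose F' : finType := {t : F | `[< exists2 x, D x & q x = t >]}.
have rP (t : F') : {x | D x & q x = val t}.
  by have /asboolP/cid2 := valP t.
exists F', (fun t => s2val (rP t)); split=> [t|x Dx].
  exact: (s2valP (rP t)).
have qx : `[< exists2 y, D y & q y = q x >] by apply/asboolP; exists x.
exists (exist _ (q x) qx : F').
have := s2valP (rP (exist _ (q x) qx : F')).
have := s2valP' (rP (exist _ (q x) qx : F')).
by move=> /= rq Dr; exact: qE.
Qed.

End finite_partition.

Lemma finpart_comp (T U : Type) (f : T -> U) (D : set T) (D' : set U)
    (E : U -> U -> Prop) : (forall x, D x -> D' (f x)) ->
  finpart D' E -> finpart D (fun x y => E (f x) (f y)).
Proof.
move=> DD' [F [q qE]]; exists F, (q \o f) => x y Dx Dy xy.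
by apply: qE => //; exact: DD'.
Qed.

Lemma finpart_image (T U : Type) (f : T -> U) (D : set T) (E : U -> U -> Prop) :
  finpart D (fun x y => E (f x) (f y)) -> finpart (f @` D) E.
Proof.
move=> [F [q qE]].
(* A point of the image takes the colour of a chosen preimage; [None] covers all other points. *)
pose k z := if pselect (exists2 x, D x & f x = z) is left H
            then Some (q (s2val (cid2 H))) else None.
exists (option F), k => z z' Dz Dz'; rewrite /k.
case: pselect => // H; case: pselect => // H' [].
by case: (cid2 H) (cid2 H') => /= x Dx <- [x' Dx' /= <-]; exact: qE.
Qed.

(** * Bounded scalar functions and the exchange of variables *)

Section scalar_partition.
Context {R : realType}.

Lemma finpart_bounded_real (T : Type) (D : set T) (f : T -> R) (M e : R) :
  (forall x, D x -> `|f x| <= M) -> 0 < e ->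
  finpart D (fun x y => `|f x - f y| <= e).
Proof.
(* The interval from [- M] to [M] is cut into cells of length [e]; [k x] is the index of the cell of
   [f x], and [N] the largest index. *)
move=> fM e0; pose k x := Num.truncn ((f x + M) / e).
pose N := Num.truncn ((M + M) / e).
have fM0 x : D x -> 0 <= (f x + M) / e.
  move=> /fM; rewrite ler_norml => /andP[f1 f2].
  by rewrite divr_ge0 ?(ltW e0)//; lra.
have kN x : D x -> (k x < N.+1)%N.
  move=> Dx; rewrite ltnS le_truncn// ler_pM2r ?invr_gt0// lerD2r.
  by have := fM _ Dx; rewrite ler_norml => /andP[].
exists 'I_N.+1, (fun x => inord (k x)) => x y Dx Dy.
move=> /(congr1 val); rewrite /= !inordK ?kN// => kxy.
have := truncn_itv (fM0 _ Dx); have := truncn_itv (fM0 _ Dy).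
rewrite -/(k x) -/(k y) kxy -natr1 !ler_pdivlMr// !ltr_pdivrMr//.
move=> /andP[? ?] /andP[? ?].
by rewrite ler_norml; apply/andP; split; lra.
Qed.

Lemma normc_le_ReIm (z : R[i]) : normc z <= `|complex.Re z| + `|complex.Im z|.
Proof.
case: z => a b /=; rewrite -[leRHS]ger0_norm ?addr_ge0// -sqrtr_sqr.
rewrite ler_wsqrtr// sqrrD !real_normK ?num_real// addrAC lerDl.
by rewrite mulrn_wge0// mulr_ge0.
Qed.

Lemma normc_ge_ReIm (z : R[i]) :
  `|complex.Re z| <= normc z /\ `|complex.Im z| <= normc z.
Proof.
case: z => a b /=; rewrite -!sqrtr_sqr.
by rewrite !ler_wsqrtr ?lerDl ?lerDr ?sqr_ge0.
Qed.

Lemma finpart_bounded (T : Type) (D : set T) (f : T -> R[i]) (M e : R) :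
  (forall x, D x -> normc (f x) <= M) -> 0 < e ->
  finpart D (fun x y => normc (f x - f y) <= e).
Proof.
move=> fM e0; have e20 : 0 < e / 2 by rewrite divr_gt0.
have fRe x : D x -> `|complex.Re (f x)| <= M.
  by move=> Dx; exact: le_trans (normc_ge_ReIm _).1 (fM _ Dx).
have fIm x : D x -> `|complex.Im (f x)| <= M.
  by move=> Dx; exact: le_trans (normc_ge_ReIm _).2 (fM _ Dx).
apply: sub_finpart (finpartI (finpart_bounded_real fRe e20)
  (finpart_bounded_real fIm e20)) => x y _ _ [].
case: (f x) (f y) => [a b] [c d] /= ac bd.
by have := normc_le_ReIm ((a +i* b) - (c +i* d)); rewrite /=; lra.
Qed.

(* A precompactness duality in the spirit of Schauder's theorem: sup over one
   variable of |g x y - g x' y| is a pseudometric on the other. *)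
Lemma finpart_swap (X Y : Type) (D : set X) (B : set Y) (g : X -> Y -> R[i]) :
  (forall x, D x -> exists M, forall y, B y -> normc (g x y) <= M) ->
  (forall e : R, 0 < e ->
    finpart D (fun x x' => forall y, B y -> normc (g x y - g x' y) <= e)) ->
  forall e : R, 0 < e ->
    finpart B (fun y y' => forall x, D x -> normc (g x y - g x y') <= e).
Proof.
move=> gM gD e e0; have e30 : 0 < e / 3 by rewrite divr_gt0.
have [F [r [Dr rD]]] := finpart_representatives (gD _ e30).
have : finpart B (fun y y' =>
    forall i : F, normc (g (r i) y - g (r i) y') <= e / 3).
  apply: finpart_forall => i; have [M gMi] := gM _ (Dr i).
  exact: finpart_bounded gMi _.
apply: sub_finpart => y y' By By' yy' x /rD[i xi].
(* The outer differences are at most [e / 3] by the choice of the representative [r i] of [x], the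
   middle one by the colouring of [B]. *)
have -> : g x y - g x y' =
    g x y - g (r i) y + (g (r i) y - g (r i) y') - (g x y' - g (r i) y').
  by ring.
have := le_normcD (g x y - g (r i) y + (g (r i) y - g (r i) y'))
  (- (g x y' - g (r i) y')).
have := le_normcD (g x y - g (r i) y) (g (r i) y - g (r i) y').
rewrite normcN; have := xi _ By; have := xi _ By'; have := yy' i; lra.
Qed.

End scalar_partition.

(** * Total boundedness and precompactness *)

Section totally_bounded.
Context {R : realType} {V : normedModType R[i]}.
Implicit Types (S : set V).

Lemma gt0_complexP (e : R[i]) : 0 < e -> exists2 r : R, 0 < r & e = r%:C.
Proof.
move=> e0; exists (complex.Re e); last by rewrite RRe_real ?gtr0_real.
by rewrite -ltcR RRe_real ?gtr0_real.
Qed.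

Lemma totally_boundedP S : totally_bounded S <->
  forall e : R, 0 < e -> finpart S (fun x y => rnorm (x - y) <= e).
Proof.
split=> [Stb e e0|Sfp _ /gt0_complexP[e e0 ->]].
  have e20 : 0 < (e / 2)%:C by rewrite ltcR divr_gt0.
  have [_ /finite_seqP[s ->] Ss] := Stb _ e20.
  (* The colour is the index of the first centre within [e / 2]; on [S] it is never the default
     [size s]. *)
  pose k x := find (fun c => `[< ball c (e / 2)%:C x >]) s.
  have ks x : S x -> has (fun c => `[< ball c (e / 2)%:C x >]) s.
    by move=> /Ss[c /= cs cx]; apply/hasP; exists c => //; exact/asboolP.
  exists 'I_(size s).+1, (fun x => inord (k x)) => x y Sx Sy.
  move=> /(congr1 val); rewrite /= !inordK ?ltnS ?find_size// => kxy.
  have /asboolP := nth_find 0 (ks _ Sx); have /asboolP := nth_find 0 (ks _ Sy).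
  rewrite -/(k x) -/(k y) kxy !ballR.
  move: (nth _ _ _) => c; have := ler_rnormD (x - c) (c - y).
  by rewrite addrA subrK (rnormB c x); lra.
(* Halving turns the large inequality of the partition into the strict one of open balls. *)
have e20 : 0 < e / 2 by rewrite divr_gt0.
have [F [r [_ rS]]] := finpart_representatives (Sfp _ e20).
exists (range r); first exact: finite_image.
move=> x /rS[i xi]; exists (r i); first by exists i.
by rewrite ballR rnormB (le_lt_trans xi)//; lra.
Qed.

Lemma totally_bounded_bounded S : totally_bounded S ->
  exists2 M : R, 0 <= M & forall x, S x -> rnorm x <= M.
Proof.
move=> /totally_boundedP /(_ _ ltr01) /finpart_representatives[F [r [_ rS]]].
exists (1 + \sum_i rnorm (r i)).
  by rewrite addr_ge0// sumr_ge0// => i _; exact: rnorm_ge0.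
move=> x /rS[i xi]; rewrite -(subrK (r i) x) (le_trans (ler_rnormD _ _))//.
rewrite lerD// (bigD1 i)//= lerDl sumr_ge0// => j _; exact: rnorm_ge0.
Qed.

Lemma precompact_totally_bounded S : precompact S -> totally_bounded S.
Proof.
move=> [U SU [+ _]] e e0; rewrite compact_cover => cU.
have [||D' _ UD'] := cU V setT (fun c => ball c e).
- by move=> c _; exact: ball_open.
- by move=> x _; exists x => //; exact: ballxx.
exists [set` D']; first exact: finite_fset.
by move=> x /SU /UD'.
Qed.

End totally_bounded.

(** If [f i] is not in the ultrafilter, its complement is, and intersecting with it removes [i] from
    the union. *)
Lemma ultra_bigcup {T : Type} {I : eqType} (F : set_system T) (s : seq I)
    (f : I -> set T) : UltraFilter F ->
  F (\bigcup_(i in [set` s]) f i) -> exists i, F (f i).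
Proof.
move=> FU; elim: s => [|i s IHs].
  by rewrite set_nil bigcup_set0 => /filter_ex[].
have [Fi|Fi] := in_ultra_setVsetC (f i) FU; first by exists i.
move=> Fis; apply: IHs; apply: filterS (filterI Fi Fis).
move=> x [nfx [j /=]]; rewrite inE => /predU1P[-> //|js fx].
by exists j.
Qed.

(** An ultrafilter containing the closure of [S] contains a ball of every radius, so it is Cauchy;
    by completeness it converges, to a point of the closure. *)
Lemma totally_bounded_precompact {R : realType}
  {V : completeNormedModType R[i]} (S : set V) :
  totally_bounded S -> precompact S.
Proof.
move=> Stb; rewrite precompactE compact_ultra => F FU FS.
have F_ : cauchy F.
  apply: cauchy_exP => _ /gt0_complexP[e e0 ->].
  have e20 : 0 < (e / 2)%:C by rewrite ltcR divr_gt0.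
  have [_ /finite_seqP[s ->] Ss] := Stb _ e20.
  apply: (ultra_bigcup (s := s)); apply: filterS FS => x Sx.
  (* As [x] is only in the closure, half of the radius is spent on reaching a point [y] of [S], half
     on reaching a centre. *)
  have [y [/Ss[c cs cy] xy]] := Sx _ (nbhsx_ballx x _ e20).
  exists c => //; move: cy xy; rewrite !ballR.
  by have := ler_rnormD (c - y) (y - x); rewrite addrA subrK (rnormB y x); lra.
have Fl : F --> lim F by exact: cauchy_cvg F_.
exists (lim F); split=> //.
exact: closed_cvg (@closed_closure _ S) FS _ Fl.
Qed.

(** * Sequence norms *)

Section lnorm.
Context {R : realType}.
Implicit Types (p q : \bar R) (x y : nat -> R[i]) (c r s : R).

(** Reduces norm bounds to finite real sums. *)
Lemma lnorm_finP s c x : 0 < s -> 0 <= c ->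
  (lnorm s%:E x <= c%:E)%E <->
  forall n, \sum_(i < n) normc (x i) `^ s <= c `^ s.
Proof.
move=> s0 c0; rewrite lnorm_fin//.
set z := (\sum_(n <oo) _)%E.
have z0 : (0 <= z)%E by apply: nneseries_ge0 => n _ _; rewrite lee_fin powR_ge0.
split=> [zc n|xc].
  have zcs : (z <= (c `^ s)%:E)%E.
    rewrite -(poweRe1 z0) -(mulVf (lt0r_neq0 s0)) poweRrM -poweR_EFin.
    apply: gt0_ler_poweR => //; first exact: ltW.
      by rewrite in_itv/= leey poweR_ge0.
    by rewrite in_itv/= leey lee_fin c0.
  rewrite -lee_fin (le_trans _ zcs)// -sumEFin /z.
  rewrite -(big_mkord xpredT (fun i => (normc (x i) `^ s)%:E)).
  by apply: nneseries_lim_ge => i _ _; rewrite lee_fin powR_ge0.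
have zcs : (z <= (c `^ s)%:E)%E.
  apply: lime_le.
    by apply: is_cvg_nneseries => n _ _; rewrite lee_fin powR_ge0.
  by apply: nearW => n; rewrite big_mkord sumEFin lee_fin.
rewrite -[c](powRr1 c0) -(divff (lt0r_neq0 s0)) powRrM -poweR_EFin.
apply: gt0_ler_poweR => //; rewrite ?invr_ge0 ?(ltW s0)//.
  by rewrite in_itv/= leey z0.
by rewrite in_itv/= leey lee_fin powR_ge0.
Qed.

Lemma lnorm_pinftyP c x :
  (lnorm +oo x <= c%:E)%E <-> forall n, normc (x n) <= c.
Proof.
rewrite lnorm_pinfty; split=> [xc n|xc]; last first.
  by apply: ge_ereal_sup => _ [n _ <-]; rewrite lee_fin.
rewrite -lee_fin (le_trans _ xc)//; apply: ereal_sup_ubound.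
by exists n.
Qed.

Lemma conjugate_cases p q : (1 < p)%E -> (p^-1 + q^-1 = 1)%E ->
  (p = +oo%E /\ q = 1%E) \/
  exists r s, [/\ p = r%:E, q = s%:E, 1 < r, 1 < s & r^-1 + s^-1 = 1].
Proof.
case: p => [r| |]//; last first.
  by move=> _ /eqP; rewrite invey add0e inve_eq1 => /eqP ->; left.
rewrite lte_fin => r1; have r0 : 0 < r by exact: lt_trans r1.
have ri : r^-1 < 1 by rewrite invf_lt1.
have ri0 : 0 < r^-1 by rewrite invr_gt0.
rewrite inver gt_eqF//; case: q => [s| |].
- rewrite inver; case: eqP => // s0 [rs]; right; exists r, s; split=> //.
  have si0 : 0 < s^-1 by lra.
  have s_gt0 : 0 < s by rewrite -invr_gt0.
  by rewrite -invf_lt1//; lra.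
- by rewrite invey adde0 => -[ri1]; rewrite ri1 ltxx in ri.
- by rewrite inveNy.
Qed.

Lemma normc_sum n (f : nat -> R[i]) :
  normc (\sum_(i < n) f i) <= \sum_(i < n) normc (f i).
Proof.
elim: n => [|n IHn]; first by rewrite !big_ord0 normc0.
by rewrite !big_ord_recr/= (le_trans (le_normcD _ _))// lerD2r.
Qed.

(** For [p = +oo] the terms are compared directly; otherwise Hoelder's inequality for the counting
    measure bounds the whole series of moduli, hence its partial sums. *)
Lemma hoelder_normc p q (a b : R) x y n :
    (1 < p)%E -> (p^-1 + q^-1 = 1)%E -> 0 <= a -> 0 <= b ->
    (lnorm q x <= a%:E)%E -> (lnorm p y <= b%:E)%E ->
  normc (\sum_(i < n) x i * y i) <= a * b.
Proof.
move=> p1 pq a0 b0 xa yb.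
apply: le_trans (normc_sum n (fun i => x i * y i)) _.
have [[pE qE]|[r [s [pE qE r1 s1 rs]]]] := conjugate_cases p1 pq.
  move: yb; rewrite pE => /lnorm_pinftyP yb.
  move: xa; rewrite qE => /(lnorm_finP _ ltr01 a0)/(_ n).
  rewrite powRr1// => xa.
  apply: (@le_trans _ _ (\sum_(i < n) normc (x i) * b)).
    by apply: ler_sum => i _; rewrite normcM ler_wpM2l ?normc_ge0.
  rewrite -mulr_suml ler_wpM2r//; apply: le_trans xa.
  by apply: ler_sum => i _; rewrite powRr1 ?normc_ge0.
have r0 : 0 < r by exact: lt_trans r1.
have s0 : 0 < s by exact: lt_trans s1.
have sr : s^-1 + r^-1 = 1 by rewrite addrC.
pose f i := normc (x i); pose g i := normc (y i).
have mf (h : nat -> R) : measurable_fun setT h by [].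
have := @hoelder _ nat R (@counting nat R) f g s r (mf _) (mf _) s0 r0 sr.
rewrite Lnorm_counting// => fg.
rewrite -lee_fin EFinM; apply: le_trans (le_trans fg _); last first.
  by apply: lee_pmul; rewrite ?Lnorm_ge0//; [rewrite qE in xa|rewrite pE in yb].
rewrite invr1 poweRe1; last by apply: nneseries_ge0 => *; exact: poweR_ge0.
rewrite -sumEFin -(big_mkord xpredT (fun i => (normc (x i * y i))%:E)).
rewrite [leLHS](eq_bigr (fun k => (`|(EFin \o (f \* g)%R) k| `^ 1)%E)).
  by apply: nneseries_lim_ge => i _ _; exact: poweR_ge0.
move=> i _ /=; rewrite powRr1// ger0_norm ?normcM//.
by rewrite mulr_ge0 ?normc_ge0.
Qed.

Lemma lnorm_unit q k : (1 <= q)%E ->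
  (lnorm q (fun i => (i == k)%:R) <= 1)%E.
Proof.
case: q => [s| |]// s1; last first.
  by apply/lnorm_pinftyP => n; case: eqP; rewrite ?normc1 ?normc0.
have s0 : 0 < s by rewrite -lte_fin (lt_le_trans _ s1).
apply/(lnorm_finP _ s0 ler01) => n; rewrite powR1.
have [kn|nk] := ltnP k n.
  rewrite (bigD1 (Ordinal kn))//= eqxx normc1 powR1 big1 ?addr0// => i ik.
  have -> : (i : nat) == k = false by exact/negbTE.
  by rewrite normc0 powR0// gt_eqF.
rewrite big1 ?ler01// => i _; have -> : (i : nat) == k = false.
  by rewrite ltn_eqF// (leq_trans _ nk).
by rewrite normc0 powR0// gt_eqF.
Qed.

(** Tests [y] against finitely supported sequences of norm at most one: unit vectors if [p = +oo],
    otherwise the equality case of Hoelder's inequality for the first [n] terms. *)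
Lemma hoelder_normc_converse p q C y : (1 < p)%E -> (p^-1 + q^-1 = 1)%E ->
    0 <= C ->
    (forall n x, (forall i, (n <= i)%N -> x i = 0) -> (lnorm q x <= 1)%E ->
      normc (\sum_(i < n) x i * y i) <= C) ->
  (lnorm p y <= C%:E)%E.
Proof.
move=> p1 pq C0 yC.
have [[pE qE]|[r [s [pE qE r1 s1 rs]]]] := conjugate_cases p1 pq.
  rewrite pE; apply/lnorm_pinftyP => k.
  have := yC k.+1 (fun i => (i == k)%:R); rewrite qE.
  rewrite big_ord_recr/= eqxx mul1r big1 ?add0r; last first.
    by move=> i _; rewrite ltn_eqF// mul0r.
  apply; first by move=> i ki; rewrite gtn_eqF.
  exact: lnorm_unit.
have r0 : 0 < r by exact: lt_trans r1.
have s0 : 0 < s by exact: lt_trans s1.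
rewrite pE; apply/(lnorm_finP _ r0 C0) => n; rewrite qE in yC.
set T := \sum_(i < n) _.
have T0 : 0 <= T by apply: sumr_ge0 => i _; exact: powR_ge0.
have [->|Tn0] := eqVneq T 0; first exact: powR_ge0.
pose u := T `^ s^-1.
have u0 : 0 < u by rewrite powR_gt0// lt0r Tn0.
have us : u `^ s = T by rewrite -powRrM mulVf ?gt_eqF// powRr1.
have Tu : T = T `^ r^-1 * u.
  by rewrite -powRD ?rs ?powRr1// Tn0 implybT.
(* The second factor cancels the argument of [y i], and is 0 where [y i = 0]. Since
   [(r - 1) * s = r], dividing by [u] makes the sum of the [s]-th powers 1, while the pairing with
   [y] is [T / u], the power of [T] with exponent [r^-1]. *)
pose x i : R[i] := if (i < n)%N
  then (normc (y i) `^ (r - 1) / u)%:C * ((normc (y i))%:C / y i) else 0.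
have rs1 : (r - 1) * s = r.
  have : r * s * (r^-1 + s^-1) = r * s by rewrite rs mulr1.
  rewrite mulrDr mulrAC divff ?gt_eqF// mulrK ?unitfE ?gt_eqF//; lra.
have normx i : (i < n)%N -> normc (x i) `^ s = normc (y i) `^ r / T.
  move=> ni; have -> : normc (x i) = normc (y i) `^ (r - 1) / u.
    rewrite /x ni !normcM !normcR normcV.
    rewrite !ger0_norm ?normc_ge0 ?divr_ge0 ?powR_ge0//.
    have [->|yi0] := eqVneq (y i) 0.
      by rewrite normc0 mul0r mulr0 powR0 ?mul0r// subr_eq0 gt_eqF.
    rewrite mulfV ?mulr1//; apply: contra_neq yi0; exact: eq0_normc.
  rewrite powRM ?powR_ge0 ?invr_ge0 ?(ltW u0)// -powRrM rs1.
  congr (_ * _); rewrite -powR_inv1 ?(ltW u0)// -powRrM mulN1r powRN us//.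
have xy i : (i < n)%N -> x i * y i = (normc (y i) `^ r / u)%:C.
  move=> ni; rewrite /x ni; have [->|yi0] := eqVneq (y i) 0.
    by rewrite mulr0 normc0 powR0 ?mul0r// gt_eqF.
  have yi : normc (y i) != 0 by apply: contra_neq yi0; exact: eq0_normc.
  rewrite -mulrA mulfVK// -rmorphM/= mulrAC; congr ((_ / _)%:C).
  by rewrite -{2}[normc (y i)]powRr1 ?normc_ge0// -powRD ?subrK// yi implybT.
have := yC n x; rewrite (eq_bigr (fun i : 'I_n => (normc (y i) `^ r / u)%:C)).
  rewrite -(rmorph_sum (real_complex R)) normcR -mulr_suml -/T.
  rewrite ger0_norm ?divr_ge0 ?(ltW u0)//.
  rewrite [X in X / u]Tu mulfK ?gt_eqF// => TC.
  have {}TC : T `^ r^-1 <= C.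
    apply: TC => [i ni|]; first by rewrite /x ltnNge ni.
    apply/(lnorm_finP _ s0 ler01) => m; rewrite powR1.
    apply: (@le_trans _ _ (\sum_(i < n) normc (y i) `^ r / T)); last first.
      by rewrite -mulr_suml divff.
    (* Both sums are extended to the common length [maxn n m] and compared termwise. *)
    rewrite (big_ord_widen_cond (maxn n m) xpredT
      (fun i => normc (x i) `^ s)) ?leq_maxr//.
    rewrite (big_ord_widen_cond (maxn n m) xpredT
      (fun i => normc (y i) `^ r / T)) ?leq_maxl//.
    rewrite big_mkcond [leRHS]big_mkcond/=; apply: ler_sum => i _.
    case: (ltnP i n) => ni.
      by rewrite normx//; case: ifP => // _; rewrite divr_ge0 ?powR_ge0.
    have -> : x i = 0 by rewrite /x ltnNge ni.
    by rewrite normc0 powR0 ?gt_eqF// if_same.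
  rewrite -[T]powRr1// -(mulVf (lt0r_neq0 r0)) powRrM.
  by apply: ge0_ler_powR; rewrite ?nnegrE ?powR_ge0// ltW.
by move=> i _; exact: xy.
Qed.

(** The partial sums of the [s]-th powers increase to a finite supremum; beyond an index where they
    are within [e] to the power [s] of it, every tail block is small. *)
Lemma lnorm_tail q x (e : R) :
    (1 <= q)%E -> (q < +oo)%E -> (lnorm q x < +oo)%E -> 0 < e ->
  exists N, forall n, (N <= n)%N ->
    (lnorm q (fun i => if (i < n)%N then 0%R else x i) <= e%:E)%E.
Proof.
case: q => [s| |]// s1 _ xoo e0.
have s0 : 0 < s by rewrite -lte_fin (lt_le_trans _ s1).
have [c c0 xc] : exists2 c, 0 <= c & (lnorm s%:E x <= c%:E)%E.
  exists (fine (lnorm s%:E x)); first by rewrite fine_ge0// lnorm_ge0.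
  by rewrite fineK// ge0_fin_numE// lnorm_ge0.
move/(lnorm_finP _ s0 c0) : xc => xc.
pose S n := \sum_(i < n) normc (x i) `^ s.
have supS : has_sup (range S).
  by split; [exists (S 0), 0%N|exists (c `^ s) => _ [n _ <-]; exact: xc].
have [_ [N _ <-] SN] := sup_adherent (powR_gt0 s e0) supS.
exists N => n Nn; apply/(lnorm_finP _ s0 (ltW e0)) => m.
have SE k l : (k <= l)%N -> S k <= S l.
  move=> kl; rewrite /S -!(big_mkord xpredT (fun i => normc (x i) `^ s)).
  rewrite [leRHS](@big_cat_nat _ _ _ k)//= lerDl.
  by apply: sumr_ge0 => *; exact: powR_ge0.
have Ssup k : S k <= sup (range S).
  by apply: ub_le_sup; [exact: supS.2|exists k].
have -> : \sum_(i < m) normc (if (i < n)%N then 0 else x i) `^ s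
    = S (maxn n m) - S n.
  rewrite /S -!(big_mkord xpredT (fun i => normc (x i) `^ s)).
  rewrite -(big_mkord xpredT
    (fun i => normc (if (i < n)%N then 0 else x i) `^ s)).
  have z k : (k <= n)%N ->
      \sum_(0 <= i < k) normc (if (i < n)%N then 0 else x i) `^ s = 0.
    move=> kn; rewrite big_nat big1// => i /andP[_ ik].
    by rewrite (leq_trans ik)// normc0 powR0// gt_eqF.
  have [nm|mn] := leqP n m; last by rewrite subrr z// ltnW.
  rewrite (@big_cat_nat _ _ _ n)//= z// add0r.
  rewrite [X in _ = X - _](@big_cat_nat _ _ _ n)//= addrAC subrr add0r.
  by apply: eq_big_nat => i /andP[ni _]; rewrite ltnNge ni.
by have := SE _ _ Nn; have := Ssup (maxn n m); lra.
Qed.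

End lnorm.

(** * Compact operators on sequence spaces *)

Section ell.
Context {R : realType} {q : \bar R} (q1 : (1 <= q)%E).
Implicit Types (v : ell q1) (c : R).

Lemma rnorm_ell v : (rnorm v)%:E = lnorm q v.
Proof. exact: fine_lnorm. Qed.

Lemma ellp_le (x : nat -> R[i]) c : (lnorm q x <= c%:E)%E -> x \in ellp q.
Proof. by move=> xc; rewrite ellpE (le_lt_trans xc) ?ltry. Qed.

Definition ell_unit k : ell q1 := Ell q1 (ellp_le (lnorm_unit k q1)).

Lemma ell_val_sum n (f : nat -> R[i]) :
  ell_val (\sum_(i < n) f i *: ell_unit i) =
  fun j => if (j < n)%N then f j else 0.
Proof.
apply/funext; elim: n => [|n IHn] j; first by rewrite big_ord0.
rewrite big_ord_recr/=.
transitivity (ell_val (\sum_(i < n) f i *: ell_unit i) j + f n * (j == n)%:R).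
  by [].
rewrite IHn ltnS; case: ltngtP => jn.
- by rewrite mulr0 addr0.
- by rewrite mulr0 addr0.
- by rewrite mulr1 add0r jn.
Qed.

(** Truncations converge in norm, so a bounded operator is determined by its values on the unit
    vectors. *)
Lemma ell_unit_approx v (e : R) : (q < +oo)%E -> 0 < e ->
  exists N, forall n, (N <= n)%N ->
    rnorm (v - \sum_(i < n) v i *: ell_unit i) <= e.
Proof.
move=> qoo e0; have [N vN] := lnorm_tail q1 qoo (ell_valP v) e0.
exists N => n /vN; rewrite -lee_fin rnorm_ell; congr (lnorm _ _ <= _)%E.
apply/funext => j.
transitivity (v j - ell_val (\sum_(i < n) v i *: ell_unit i) j); last by [].
by rewrite ell_val_sum; case: ifP; rewrite ?subrr ?subr0.
Qed.

End ell.

(** * From compact operators to sequences *)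

Section compact_ellc.
Context {R : realType} {A : normedModType R[i]} {p q : \bar R}.
Context (p1 : (1 < p)%E) (q1 : (1 <= q)%E) (pq : (p^-1 + q^-1 = 1)%E).
Implicit Types (phi psi : {linear A -> R[i]^o}).

Lemma conjugate_lt_pinfty : (q < +oo)%E.
Proof.
have [[_ ->]|[r [s [_ -> _ _ _]]]] := conjugate_cases p1 pq; exact: ltry.
Qed.

(** Half of the duality between l^q and l^p: a finitely supported test sequence is a combination [v]
    of unit vectors, and its pairing with the coordinates of [f] is [f v]. *)
Lemma lnorm_functional (f : {linear ell q1 -> R[i]^o}) (C : R) : 0 <= C ->
    (forall v, rnorm v <= 1 -> normc (f v) <= C) ->
  (lnorm p (fun i => f (ell_unit q1 i)) <= C%:E)%E.
Proof.
move=> C0 fC; apply: (hoelder_normc_converse p1 pq C0) => n x xn x1.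
pose v := \sum_(i < n) x i *: ell_unit q1 i.
have vx : ell_val v = x.
  by rewrite ell_val_sum; apply/funext => j; case: ltnP => // /xn.
have : normc (f v) <= C by apply: fC; rewrite -lee_fin rnorm_ell vx.
by rewrite linear_sum; under eq_bigr => i _ do rewrite linearZ.
Qed.

(** [L] is given as a linear map only; its boundedness is recovered here by rescaling to the unit
    ball. *)
Lemma totally_bounded_linear_le (L : {linear ell q1 -> A}) :
  totally_bounded (L @` [set v | rnorm v <= 1]) ->
  exists2 M, 0 <= M & forall v, rnorm (L v) <= M * rnorm v.
Proof.
move=> /totally_bounded_bounded[M M0 LM]; exists M => // v.
have [->|v0] := eqVneq v 0; first by rewrite linear0 !rnorm0 mulr0.
have nv0 : 0 < rnorm v.
  by rewrite lt0r rnorm_ge0 andbT; apply: contra_neq v0; exact: rnorm_eq0.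
have : rnorm (L ((rnorm v)^-1%:C *: v)) <= M.
  apply: LM; exists ((rnorm v)^-1%:C *: v) => //=.
  by rewrite rnormZ normcR ger0_norm ?invr_ge0 ?rnorm_ge0// mulVf// gt_eqF.
rewrite linearZ rnormZ normcR ger0_norm ?invr_ge0 ?rnorm_ge0//.
by rewrite ler_pdivrMl// mulrC.
Qed.

Lemma Lambda_unit (L : {linear ell q1 -> A}) (M : R) : 0 <= M ->
    (forall v, rnorm (L v) <= M * rnorm v) ->
  forall v, L v = Lambda (fun i => L (ell_unit q1 i)) v.
Proof.
move=> M0 LM v; apply/esym/cvg_lim => //.
apply/cvgrPdist_le => _ /gt0_complexP[e e0 ->].
(* [M + 1] because [M] may be 0. *)
have e'0 : 0 < e / (M + 1) by rewrite divr_gt0// ltr_wpDl.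
have [N vN] := ell_unit_approx v conjugate_lt_pinfty e'0.
exists N => // n /vN vn /=.
have -> : series (fun i => v i *: L (ell_unit q1 i)) n =
    L (\sum_(i < n) v i *: ell_unit q1 i).
  rewrite /series/= big_mkord linear_sum.
  by apply: eq_bigr => i _; rewrite linearZ.
rewrite -linearB normE lecR (le_trans (LM _))//.
rewrite (le_trans (ler_wpM2l M0 vn))// mulrCA ger_pMr// ler_pdivrMr ?ltr_wpDl//.
by rewrite mul1r lerDl.
Qed.

Lemma totally_bounded_ellc (L : {linear ell q1 -> A}) :
  totally_bounded (L @` [set v | rnorm v <= 1]) ->
  ellc (ltW p1) (fun i => L (ell_unit q1 i)).
Proof.
move=> Ltb; have [M M0 LM] := totally_bounded_linear_le Ltb.
have LM1 v : rnorm v <= 1 -> rnorm (L v) <= M.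
  by move=> v1; rewrite (le_trans (LM v))// ler_piMr.
split=> [_ [phi /dual_ballP phi1 <-]|].
  apply: (@ellp_le _ _ _ M).
  apply: (@lnorm_functional (phi \o L)%FUN) => // v v1.
  exact: le_trans (phi1 _) (LM1 v v1).
apply/totally_boundedP => e e0.
(* [dual_image] consists of bare sequences, so the partition is built there and then pulled back to
   [ell] along [ell_val]. *)
pose near_e (x y : nat -> R[i]) := (lnorm p (x - y)%R <= e%:E)%E.
suff : finpart (dual_image (fun i => L (ell_unit q1 i))) near_e.
  move=> dfp; apply: sub_finpart (finpart_comp (f := ell_val) _ dfp) => // v w.
  by move=> _ _; rewrite -lee_fin rnorm_ell.
apply: finpart_image.
(* The ball of l^q is partitioned through [L v], uniformly over the dual ball; the exchange
   partitions the dual ball, and [lnorm_functional] for the difference of two functionals yields the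
   p-norm. *)
apply: sub_finpart (@finpart_swap _ _ _ [set v : ell q1 | rnorm v <= 1]
  (@dual_ball R A) (fun v phi => phi (L v)) _ _ e e0).
- move=> phi psi _ _ phipsi.
  exact: (@lnorm_functional ((phi \- psi) \o L)%FUN e (ltW e0) phipsi).
- move=> v _; exists (rnorm (L v)) => phi /dual_ballP; exact.
- move=> d d0; have /totally_boundedP/(_ d d0) := Ltb.
  move=> Lfp; apply: sub_finpart (finpart_comp (f := L) _ Lfp) => [v w|v v1].
    by move=> _ _ vw phi /dual_ballP phi1; rewrite -linearB (le_trans (phi1 _)).
  by exists v.
Qed.

End compact_ellc.

(** * From sequences to compact operators *)

Section ellc_compact.
Context {R : realType} {A : completeNormedModType R[i]} {p q : \bar R}.
Context (p1 : (1 < p)%E) (q1 : (1 <= q)%E) (pq : (p^-1 + q^-1 = 1)%E).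
Implicit Types (phi psi : {linear A -> R[i]^o}) (a : nat -> A).

Lemma ellc_bounded a : ellc (ltW p1) a ->
  exists2 M : R, 0 <= M & forall phi, dual_ball phi ->
    (lnorm p (fun i => phi (a i)) <= M%:E)%E.
Proof.
move=> [aS /totally_bounded_bounded[M M0 aM]]; exists M => // phi phi1.
have ap : (fun i => phi (a i)) \in ellp p by apply: aS; exists phi.
have := aM (Ell (ltW p1) ap); rewrite -lee_fin rnorm_ell; apply.
by exists phi.
Qed.

(* A block of the series is bounded, through a norming functional phi, by the
   q-norm of a tail of v times a bound on the p-norms of the phi(a). *)
Lemma cvg_Lambda a (v : ell q1) : ellc (ltW p1) a ->
  series (fun i => v i *: a i) @ \oo --> Lambda a v.
Proof.
move=> /ellc_bounded[M M0 aM]; apply: (@cauchy_cvg A).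
apply/cauchy_seriesP => _ /gt0_complexP[e e0 ->].
have e'0 : 0 < e / (M + 1) by rewrite divr_gt0// ltr_wpDl.
have qoo := conjugate_lt_pinfty p1 pq.
have [N vN] := lnorm_tail q1 qoo (ell_valP v) e'0.
exists ([set n | (N <= n)%N], [set n | (N <= n)%N]).
  by split; exists N.
move=> [n m] /= [Nn Nm]; rewrite normE ltcR.
have [mn|nm] := leqP m n; first by rewrite big_geq// rnorm0.
have [phi phi1 nphi] := norming_functional (\sum_(n <= i < m) v i *: a i).
apply: le_lt_trans nphi _.
(* The block is padded with zeros below [n], to become a partial sum for the tail of [v]. *)
have -> : phi (\sum_(n <= i < m) v i *: a i) =
    \sum_(i < m) (if (i < n)%N then 0 else v i) * phi (a i).
  rewrite -(big_mkord xpredT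
    (fun i => (if (i < n)%N then 0 else v i) * phi (a i))).
  rewrite (@big_cat_nat _ _ _ n 0 m)//=; last exact: ltnW.
  rewrite [X in _ = X + _](_ : _ = 0) ?add0r; last first.
    by rewrite big_nat big1// => i /andP[_ ->]; rewrite mul0r.
  rewrite linear_sum; apply: eq_big_nat => i /andP[ni _].
  by rewrite linearZ ltnNge ni.
apply: le_lt_trans (hoelder_normc m p1 pq (ltW e'0) M0 (vN _ Nn) (aM _ phi1)) _.
by rewrite mulrAC -mulrA gtr_pMr// ltr_pdivrMr ?ltr_wpDl// mul1r ltrDl.
Qed.

(** Hoelder's inequality on partial sums; [K] serves to pass to the limit. It is arbitrary so that
    differences of two members of the dual ball, with [K = 2], are covered. *)
Lemma Lambda_functional a (v : ell q1) phi (K c : R) : ellc (ltW p1) a ->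
    0 <= K -> (forall x, normc (phi x) <= K * rnorm x) -> 0 <= c ->
    (lnorm p (fun i => phi (a i)) <= c%:E)%E ->
  normc (phi (Lambda a v)) <= rnorm v * c.
Proof.
move=> ac K0 phiK c0 phic; apply/ler_addgt0Pr => e e0.
have e'0 : 0 < (e / (K + 1))%:C by rewrite ltcR divr_gt0// ltr_wpDl.
have /cvgrPdist_le/(_ _ e'0)[N _ aN] := cvg_Lambda (v := v) ac.
have := aN N (leqnn N); rewrite /= normE lecR => {}aN.
set x := series _ N in aN.
have -> : phi (Lambda a v) = phi x + phi (Lambda a v - x).
  by rewrite linearB addrC subrK.
rewrite (le_trans (le_normcD _ _))// lerD//.
  have -> : phi x = \sum_(i < N) v i * phi (a i).
    rewrite /x /series/= big_mkord linear_sum.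
    by apply: eq_bigr => i _; rewrite linearZ.
  have vn : (lnorm q v <= (rnorm v)%:E)%E by rewrite rnorm_ell.
  exact: hoelder_normc N p1 pq (rnorm_ge0 v) c0 vn phic.
rewrite (le_trans (phiK _))// (le_trans (ler_wpM2l K0 aN))//.
by rewrite mulrCA ger_pMr// ler_pdivrMr ?ltr_wpDl// mul1r lerDl.
Qed.

Lemma ellc_totally_bounded a (L : {linear ell q1 -> A}) :
  ellc (ltW p1) a -> (forall v, L v = Lambda a v) ->
  totally_bounded (L @` [set v | rnorm v <= 1]).
Proof.
move=> ac La; have [M M0 aM] := ellc_bounded ac.
apply/totally_boundedP => e e0; apply: finpart_image.
apply: sub_finpart (@finpart_swap _ _ _ (@dual_ball R A)
  [set v : ell q1 | rnorm v <= 1] (fun phi v => phi (L v)) _ _ e e0).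
(* A functional norming [L v - L w] turns uniform closeness over the dual ball into closeness in
   norm. *)
- move=> v w _ _ vw; have [phi phi1 nphi] := norming_functional (L v - L w).
  by rewrite (le_trans nphi)// linearB; exact: vw.
- move=> phi phi1; exists M => v v1; rewrite La.
  have phiK x : normc (phi x) <= 1 * rnorm x.
    by rewrite mul1r; move/dual_ballP : phi1; exact.
  rewrite (le_trans (Lambda_functional v ac ler01 phiK M0 (aM _ phi1)))//.
  by rewrite ler_piMl.
move=> d d0; have [aS /totally_boundedP/(_ d d0)] := ac.
(* [f phi] is the sequence [phi (a i)] as an element of l^p, with default 0 off the dual ball. *)
have [phi|f fE] := @choice _ _ (fun (phi : {linear A -> R[i]^o})
    (v : ell (ltW p1)) => dual_ball phi -> ell_val v = fun i => phi (a i)).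
  have [phi1|phi1] := pselect (dual_ball phi); last by exists 0.
  have ap : (fun i => phi (a i)) \in ellp p by apply: aS; exists phi.
  by exists (Ell (ltW p1) ap).
move=> afp; apply: sub_finpart (finpart_comp (f := f) _ afp) =>
  [phi psi phi1 psi1|phi phi1]; last first.
  by exists phi => //; rewrite fE.
rewrite -lee_fin rnorm_ell => phipsi v v1; rewrite La.
pose chi : {linear A -> R[i]^o} := (phi \- psi)%FUN.
have chi2 x : normc (chi x) <= 2 * rnorm x.
  have := le_normcD (phi x) (- psi x); rewrite normcN.
  by move/dual_ballP : phi1 => /(_ x); move/dual_ballP : psi1 => /(_ x) /=; lra.
have chid : (lnorm p (fun i => chi (a i)) <= d%:E)%E.
  apply: le_trans phipsi.
  rewrite (_ : ell_val _ = fun i => phi (a i) - psi (a i))//.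
  apply/funext => i.
  transitivity (ell_val (f phi) i - ell_val (f psi) i); first by [].
  by rewrite (fE _ phi1) (fE _ psi1).
apply: le_trans (Lambda_functional v ac (ler0n R 2) chi2 (ltW d0) chid) _.
by rewrite ler_piMl// ltW.
Qed.

End ellc_compact.

Theorem theorem3p6 (R : realType) (A : completeNormedModType R[i])
    (p q : \bar R) (p1 : (1 < p)%E) (q1 : (1 <= q)%E)
    (pq : (p^-1 + q^-1 = 1)%E) (L : {linear ell q1 -> A}) :
  compact_operator L <->
  exists2 a : nat -> A, ellc (ltW p1) a & forall b : ell q1, L b = Lambda a b.
Proof.
have -> : compact_operator L = precompact (L @` [set v | rnorm v <= 1]).
  congr (precompact (_ @` _)); apply/funext => v.
  by rewrite /= normE -(rmorph1 (real_complex R)) lecR.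
split=> [/precompact_totally_bounded Ltb|[a ac La]].
  have [M M0 LM] := totally_bounded_linear_le Ltb.
  (* The sequence consists of the images of the unit vectors. *)
  exists (fun i => L (ell_unit q1 i)).
    exact: (totally_bounded_ellc p1 pq Ltb).
  exact: (Lambda_unit p1 pq M0 LM).
apply: totally_bounded_precompact; exact: ellc_totally_bounded pq _ _ ac La.
Qed.
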